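(* A ring $R$ is a $\tau_q$-semisimple ring if and only if the formal power series ring $R[\![x_1,\dots,x_n]\!]$ is a $\tau_q$-semisimple ring.
   Context: All rings are commutative with identity; $n$ is a positive integer. For a ring $R$: an ideal $I$ is dense if $(0:_R I)=\{r\in R: Ir=0\}=0$, and semi-regular if it contains a finitely generated dense ideal. $\mathcal{Q}$ denotes the set of finitely generated semi-regular ideals of $R$. An $R$-module $N$ is $\mathcal Q$-torsion-free if $Iy=0$ with $I\in\mathcal Q$, $y\in N$ implies $y=0$. A $\mathcal Q$-torsion-free module $N$ is strongly Lucas if $\mathrm{Ext}^k_R(R/I,N)=0$ for every $I\in\mathcal Q$ and every $k\ge1$. An $R$-module $P$ is $\tau_q$-projective if $\mathrm{Ext}^1_R(P,N)=0$ for every strongly Lucas $R$-module $N$. The $\tau_q$-projective dimension $\tau_q\text{-pd}_R(M)$ is the least $k\ge 0$ such that there is an exact sequence $0\to P_k\to\cdots\to P_0\to M\to 0$ with all $P_i$ $\tau_q$-projective ($\infty$ if none exists), and $\tau_q\text{-gl.dim}(R)=\sup\{\tau_q\text{-pd}_R(M): M\text{ an }R\text{-module}\}$. $R$ is $\tau_q$-semisimple if $\tau_q\text{-gl.dim}(R)=0$, i.e. every $R$-module is $\tau_q$-projective. *)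

(* Defs.v *)
From HB Require Import structures.
From mathcomp Require Import all_boot all_order all_algebra.
From mathcomp Require Import boolp classical_sets functions.
From mathcomp Require Import ssrcomplements mpoly.

Set Implicit Arguments.
Unset Strict Implicit.
Unset Printing Implicit Defensive.

Import GRing.Theory.

Local Open Scope ring_scope.
Local Open Scope quotient_scope.

(* Rings are [comPzRingType]s, so the zero ring is allowed. An ideal of R is a
   [submodClosed R^o], i.e. an R-submodule of the regular module R^o; its
   membership predicate is bool-valued, which is no restriction since
   [mathcomp.classical] makes every proposition decidable. *)

(* -------------------------------------------------------------------- *)
(* Formal power series R[[x_0, ..., x_(n-1)]]: a series is its family of
   coefficients, indexed by the monomials 'X_{1..n}. *)
Definition mpowser (n : nat) (R : Type) : Type := 'X_{1..n} -> R.

Section PowerSeriesRing.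
Variables (n : nat) (R : comPzRingType).
Implicit Types (f g h : mpowser n R) (m : 'X_{1..n}).

HB.instance Definition _ := GRing.Zmodule.copy (mpowser n R) ('X_{1..n} -> R).

Definition mpowser1 : mpowser n R := fun m => (m == 0%MM)%:R.

(* The bound on the degrees of [k.1] and [k.2] only makes the index type
   finite: it is implied by [m = k.1 + k.2]. *)
Definition mpowser_mul f g : mpowser n R := fun m =>
  \sum_(k : 'X_{1..n < (mdeg m).+1, (mdeg m).+1} | m == (k.1 + k.2)%MM)
     f k.1 * g k.2.

Lemma mpowser_mulE f g m b : (mdeg m < b)%N ->
  mpowser_mul f g m = \sum_(k : 'X_{1..n < b} | (k <= m)%MM) f k * g (m - k)%MM.
Proof.
move=> lt_mb; rewrite /mpowser_mul.
set d := (mdeg m).+1.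
transitivity (\sum_(k : 'X_{1..n < d} | (k <= m)%MM) f k * g (m - k)%MM).
  pose P (k1 k2 : 'X_{1..n < d}) := m == (k1 + k2)%MM.
  pose Q (k : 'X_{1..n < d}) := (k <= m)%MM.
  pose F (k1 k2 : 'X_{1..n < d}) := f k1 * g k2.
  rewrite -(pair_big_dep xpredT P F) (bigID Q) /= addrC.
  (rewrite big1 ?add0r {}/P {}/Q; first apply/eq_bigr)=> /= h1.
  + move=> le_h1_m; have pr: (mdeg (m - h1)%MM < d)%N by rewrite ltnS mdegB.
    rewrite (big_pred1 (BMultinom pr)) //= => h2 /=.
    rewrite bmeqP /=; apply/eqP/eqP=> ->.
    * by rewrite addmC addmK.
    * by rewrite addmC submK //; apply/mnm_lepP.
  + rewrite negb_forall => /existsP /= [i Nle].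
    rewrite big_pred0 //= => h2; apply/negbTE/eqP.
    move/mnmP/(_ i); rewrite mnmDE=> eq; move: Nle.
    by rewrite eq leq_addr.
pose Id : subFinType _ := 'X_{1..n < d}.
pose Ib : subFinType _ := 'X_{1..n < b}.
pose F (k : 'X_{1..n}) := f k * g (m - k)%MM.
rewrite (big_sub_widen Id Ib (fun k => (k <= m)%MM) F) /=; last first.
  by move=> x /leq_trans; apply.
apply: eq_bigl => k; case le_km: (k <= m)%MM => //=.
rewrite ltnS; apply/idP; move/mnm_lepP: le_km => le_km.
by rewrite !mdegE leq_sum.
Qed.

Lemma mpowser_mulC : commutative mpowser_mul.
Proof.
move=> f g; apply/funext => m; rewrite /mpowser_mul.
rewrite [LHS]big_mkcond [RHS]big_mkcond big_pairA /=.
rewrite exchange_big pair_bigA /=.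
by apply: eq_bigr => k _; rewrite addmC mulrC.
Qed.

Lemma mpowser_mul_revE f g m b : (mdeg m < b)%N ->
  mpowser_mul f g m = \sum_(k : 'X_{1..n < b} | (k <= m)%MM) f (m - k)%MM * g k.
Proof.
move=> lt_mb; rewrite mpowser_mulC (mpowser_mulE _ _ lt_mb).
by apply: eq_bigr => k _; rewrite mulrC.
Qed.

Lemma mpowser_mulA : associative mpowser_mul.
Proof.
move=> p q r; apply/funext => mi; set b := (mdeg mi).+1.
have lt_b m: (mdeg (mi - m)%MM < b)%N by rewrite ltnS mdegB.
rewrite (@mpowser_mulE _ _ _ b) // (@mpowser_mul_revE _ _ _ b) //.
pose coef3 mj mk := p mj * (q (mi - mj - mk)%MM * r mk).
transitivity (\sum_(mj : 'X_{1..n < b} | (mj <= mi)%MM)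
                \sum_(mk : 'X_{1..n < b} | (mk <= mi - mj)%MM)
                   coef3 mj mk).
  by apply/eq_bigr=> /= mj _; rewrite (mpowser_mul_revE _ _ (lt_b _)) big_distrr.
pose P (mj : 'X_{1..n < b}) := (mj <= mi)%MM.
rewrite (exchange_big_dep P) //= {}/P; last first.
  by move=> mj mk _ /lepm_trans; apply; apply/lem_subr.
apply/eq_bigr=> /= mk /mnm_lepP le_mk_mi.
transitivity (\sum_(mj : 'X_{1..n < b} | (mj <= mi - mk)%MM) coef3 mj mk).
  apply/eq_bigl=> m /=.
  apply/idP/idP => [/andP[/mnm_lepP le1 /mnm_lepP le2]|le1].
    apply/mnm_lepP => i; rewrite mnmBE /leq subnBA // addnC -subnBA //.
    by rewrite -mnmBE; apply/le2.
  have le2: (m <= mi)%MM by rewrite (lepm_trans le1) ?lem_subr.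
  rewrite le2; apply/mnm_lepP=> i; rewrite mnmBE /leq.
  move/mnm_lepP: le2 => le2; rewrite subnBA // addnC.
  by rewrite -subnBA //; move/mnm_lepP/(_ i): le1; rewrite mnmBE.
rewrite (mpowser_mulE _ _ (lt_b _)) /coef3 big_distrl /=.
by apply/eq_bigr=> mj _; rewrite !mulrA !submDA addmC.
Qed.

Lemma mpowser_mul1m : left_id mpowser1 mpowser_mul.
Proof.
move=> f; apply/funext => m.
rewrite (mpowser_mulE _ _ (ltnSn _)) (bigD1 bm0) /=; last first.
  by apply/mnm_lepP => i; rewrite mnm0E.
rewrite /mpowser1 eqxx mul1r subm0 big1 ?addr0 // => k /andP[_].
by rewrite bmeqP /= => /negPf ->; rewrite mul0r.
Qed.

Lemma mpowser_mulDl : left_distributive mpowser_mul +%R.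
Proof.
move=> f g h; apply/funext => m.
rewrite /mpowser_mul [RHS]/GRing.add /= -big_split /=.
by apply: eq_bigr => k _; rewrite -mulrDl.
Qed.

HB.instance Definition _ := GRing.Zmodule_isComPzRing.Build (mpowser n R)
  mpowser_mulA mpowser_mulC mpowser_mul1m mpowser_mulDl.

End PowerSeriesRing.

(* -------------------------------------------------------------------- *)
(* The cyclic module R/I: [Quotient.quot] only provides the additive group. *)
Section QuotientModule.
Variables (R : comPzRingType) (I : submodClosed R^o).

Definition ideal_pred : {pred R^o} := fun x => x \in I.

Fact ideal_predE x : (x \in ideal_pred) = (x \in I). Proof. by []. Qed.

Fact ideal_pred_zmod_closed : zmod_closed ideal_pred.
Proof.
split=> [|x y]; rewrite !ideal_predE ?rpred0 // => Ix Iy.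
by rewrite rpredD // -scaleN1r rpredZ.
Qed.

HB.instance Definition _ :=
  GRing.isZmodClosed.Build R^o ideal_pred ideal_pred_zmod_closed.

Definition quot_ideal : Type := Quotient.quot ideal_pred.

HB.instance Definition _ := GRing.Zmodule.on quot_ideal.
HB.instance Definition _ := EqQuotient.on quot_ideal.

Definition quot_ideal_scale (a : R) : quot_ideal -> quot_ideal :=
  lift_op1 quot_ideal (fun x : R^o => a *: x).

Fact pi_quot_idealD : {morph \pi_quot_ideal : x y / (x + y : R^o) >-> x + y}.
Proof. exact: (raddfD (\pi_(Quotient.quot ideal_pred))). Qed.

Fact pi_quot_ideal_scale a :
  {morph \pi_quot_ideal : x / (a *: x : R^o) >-> quot_ideal_scale a x}.
Proof.
move=> x; unlock quot_ideal_scale; apply/eqP.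
rewrite -Quotient.idealrBE -scalerBr ideal_predE rpredZ //.
by rewrite -ideal_predE Quotient.idealrBE reprK.
Qed.

Fact quot_ideal_scaleA a b v :
  quot_ideal_scale a (quot_ideal_scale b v) = quot_ideal_scale (a * b) v.
Proof. by rewrite -[v]reprK -!pi_quot_ideal_scale scalerA. Qed.

Fact quot_ideal_scale1 : left_id 1 quot_ideal_scale.
Proof. by move=> v; rewrite -[v]reprK -!pi_quot_ideal_scale scale1r. Qed.

Fact quot_ideal_scaleDr : right_distributive quot_ideal_scale +%R.
Proof.
move=> a u v; rewrite -[u]reprK -[v]reprK.
by rewrite -pi_quot_idealD -!pi_quot_ideal_scale -pi_quot_idealD scalerDr.
Qed.

Fact quot_ideal_scaleDl v : {morph quot_ideal_scale^~ v : a b / a + b}.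
Proof.
by move=> a b; rewrite -[v]reprK -!pi_quot_ideal_scale -pi_quot_idealD scalerDl.
Qed.

HB.instance Definition _ := GRing.Zmodule_isLmodule.Build R quot_ideal
  quot_ideal_scaleA quot_ideal_scale1 quot_ideal_scaleDr quot_ideal_scaleDl.

End QuotientModule.

(* -------------------------------------------------------------------- *)
Section SemiRegularIdeals.
Variable R : comPzRingType.
Implicit Types I J : submodClosed R^o.

Definition dense_ideal I := forall r : R,
  (forall a : R, a \in I -> a * r = 0) -> r = 0.

Definition fg_ideal I := exists s : seq R, forall x : R,
  x \in I <-> exists c : 'I_(size s) -> R, x = \sum_(i < size s) c i * s`_i.

Definition semiregular_ideal I := exists J,
  [/\ {subset J <= I}, fg_ideal J & dense_ideal J].

(* The set Q of finitely generated semi-regular ideals. *)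
Definition calQ I := fg_ideal I /\ semiregular_ideal I.

Definition Q_torsion_free (N : lmodType R) := forall I, calQ I ->
  forall y : N, (forall a : R, a \in I -> a *: y = 0) -> y = 0.

End SemiRegularIdeals.

(* -------------------------------------------------------------------- *)
Section Homology.
Variable R : comPzRingType.
Implicit Types M N P : lmodType R.

Definition projective_module P := forall (A B : lmodType R)
    (p : {linear A -> B}) (f : {linear P -> B}),
  (forall b, exists a, p a = b) ->
  exists g : {linear P -> A}, forall x, p (g x) = f x.

(* A left resolution of M: an exact sequence ... -> P_1 -> P_0 -> M -> 0. *)
Record resolution M := Resolution {
  res_obj :> nat -> lmodType R;
  res_d : forall i, {linear res_obj i.+1 -> res_obj i};
  res_eps : {linear res_obj 0%N -> M};
  res_surj : forall y, exists x, res_eps x = y;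
  res_exact0 : forall x, res_eps x = 0 <-> exists y, res_d 0 y = x;
  res_exact : forall i x, res_d i x = 0 <-> exists y, res_d i.+1 y = x
}.

Definition cocycle M (P : resolution M) N k (f : {linear P k -> N}) :=
  forall x, f (res_d P k x) = 0.

Definition coboundary M (P : resolution M) N k :
    {linear P k -> N} -> Prop :=
  match k with
  | 0 => fun f => forall x, f x = 0
  | j.+1 => fun f => exists g : {linear P j -> N}, forall x, f x = g (res_d P j x)
  end.

(* [Ext_eq0 k M N] is Ext^k_R(M, N) = 0, where Ext^k_R(M, N) is the k-th
   cohomology group of the complex Hom_R(P, N) for a projective resolution P
   of M. As this group does not depend on P, all P are considered. *)
Definition Ext_eq0 k M N := forall P : resolution M,
  (forall i, projective_module (P i)) ->
  forall f : {linear P k -> N}, cocycle f -> coboundary f.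

Definition strongly_Lucas N := Q_torsion_free N /\
  forall I : submodClosed R^o, calQ I ->
  forall k : nat, (1 <= k)%N -> Ext_eq0 k (quot_ideal I) N.

Definition tauq_projective P := forall N, strongly_Lucas N -> Ext_eq0 1 P N.

(* There is an exact sequence 0 -> P_k -> ... -> P_0 -> M -> 0 with all the
   P_i tau_q-projective. *)
Definition tauq_resolved M k := exists P : resolution M,
  (forall i, (i <= k)%N -> tauq_projective (P i)) /\
  (forall i, (k < i)%N -> forall x : P i, x = 0).

(* Extended natural numbers are [option nat], with [None] for infinity;
   [least A] is the infimum of A in there. *)
Definition least (A : nat -> Prop) : option nat :=
  if pselect (exists k, `[< A k >]) is left exA then Some (ex_minn exA) else None.

Definition tauq_pd M : option nat := least (tauq_resolved M).

(* The supremum of all the dimensions, as their least upper bound. *)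
Definition tauq_gldim : option nat :=
  least (fun d => forall M, if tauq_pd M is Some k then (k <= d)%N else false).

Definition tauq_semisimple := tauq_gldim = Some 0%N.

End Homology.

Section SemisimpleP.
Variable R : comPzRingType.
Implicit Types M N P : lmodType R.

Lemma least_eq0 (A : nat -> Prop) : least A = Some 0%N <-> A 0%N.
Proof.
rewrite /least; case: pselect => [exA|nexA]; last first.
  by split=> // A0; case: nexA; exists 0%N; apply/asboolP.
case: ex_minnP => k /asboolP Ak k_min; split=> [[<-]//|A0].
by have /k_min := asboolT A0; rewrite leqn0 => /eqP ->.
Qed.

Lemma tauq_projective_iso P M (e : {linear P -> M}) :
  injective e -> (forall y, exists x, e x = y) ->
  tauq_projective P -> tauq_projective M.
Proof.
move=> e_inj e_surj projP N NL Q Qproj f.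
pose g y := projT1 (cid (e_surj y)).
have gK y : e (g y) = y by rewrite /g; case: cid.
have g_lin : linear g.
  by move=> a x y; apply: e_inj; rewrite linearP !gK.
pose gL := GRing.isLinear.Build _ _ _ _ g g_lin.
pose gl : {linear M -> P} := HB.pack g gL.
have surj' y : exists x, (gl \o res_eps Q) x = y.
  have [x ex] := res_surj Q (e y); exists x.
  by apply: e_inj; rewrite /= gK.
have exact0' x : (gl \o res_eps Q) x = 0 <-> exists y, res_d Q 0 y = x.
  rewrite -res_exact0 /=; split=> [gx0|->]; last exact: (linear0 gl).
  by rewrite -[LHS]gK gx0 linear0.
exact: (projP N NL (Resolution surj' exact0' (@res_exact _ _ Q)) Qproj f).
Qed.

Lemma tauq_resolved0 M : tauq_resolved M 0 <-> tauq_projective M.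
Proof.
split=> [[P [projP P0]]|projM].
  apply: (@tauq_projective_iso (P 0%N) M (res_eps P)); last exact: projP.
    apply: raddf_inj => x /res_exact0[y <-].
    by rewrite [y]P0 // linear0.
  exact: res_surj.
pose C i : lmodType R := if i is 0 then M else 'rV[R]_0.
pose d i : {linear C i.+1 -> C i} := \0.
have C0 i (x y : C i.+1) : x = y by rewrite [x]thinmx0 [y]thinmx0.
have surj y : exists x, (idfun : {linear C 0%N -> M}) x = y by exists y.
have exact0 x : (idfun : {linear C 0%N -> M}) x = 0 <-> exists y, d 0%N y = x.
  by split=> [/= ->|[y <-]//]; exists 0.
have exact i x : d i x = 0 <-> exists y, d i.+1 y = x.
  by split=> // _; exists 0; apply: C0.
exists (Resolution surj exact0 exact); split=> [[|i]//|[|i]]// _ x.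
Qed.

Lemma tauq_semisimpleP :
  tauq_semisimple R <-> forall M, tauq_projective M.
Proof.
rewrite /tauq_semisimple /tauq_gldim least_eq0; split=> ss M.
  apply/tauq_resolved0/least_eq0; rewrite -/(tauq_pd M).
  by case: (tauq_pd M) (ss M) => // k; rewrite leqn0 => /eqP ->.
by have /tauq_resolved0/least_eq0 := ss M; rewrite /tauq_pd => ->.
Qed.

End SemisimpleP.

(* Main.v *)
Require Import Defs.
From mathcomp Require Import all_boot all_order all_algebra.
From HB Require Import structures.
From mathcomp Require Import boolp classical_sets functions fsbigop.
From mathcomp Require Import ssrcomplements mpoly ring.

(* Both rings are tau_q-semisimple exactly when 0 is a finite intersection of
   prime ideals. This property passes from R to R[[x]] through P |-> P[[x]], and
   back by contraction to R.

   The ring R is tau_q-semisimple when all strongly Lucas modules N are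
   injective. If 0 is an irredundant intersection of primes P_1, ..., P_m, every ideal J
   contains some a such that a + b is regular for some b killing J. Regular
   elements act bijectively on N, so a map f : J -> N is multiplication by
   f(a) / (a + b), and Baer's criterion applies.

   Conversely let X be the set of primes containing no finitely generated dense
   ideal. For P_0, P_1, ... in X, the direct sum N of the fraction fields of the
   R/P_j is strongly Lucas: given I in Q with generators x_k, split the indices j
   according to a k with x_k not in P_j; then x_k is invertible on the k-th part
   of N, so that id_N is in I.End(N), which forces Ext(R/I, N) = 0. Injectivity
   of N for constant P_j = P containing Ann(a) extends ra |-> r, and shows that
   a is not in P: hence the primes in X intersect in 0. If x_0, x_1, ... were
   nonzero and pairwise orthogonal, choosing P_j in X with x_j not in P_j and
   extending r |-> (r x_j)_j from the ideal where it has finite support gives a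
   contradiction. So there is no such sequence, each nonzero element has a
   nonzero multiple u with Ann(u) prime, and finitely many of these Ann(u)
   intersect in 0. *)

Set Implicit Arguments.
Unset Strict Implicit.
Unset Printing Implicit Defensive.

Import Order.TTheory GRing.Theory.

Local Open Scope ring_scope.
Local Open Scope quotient_scope.

(** * Free modules *)

Section FreeModule.
Variables (R : comPzRingType) (X : choiceType).

Definition finsupp : {pred X -> R^o} :=
  fun f => `[< exists s : seq X, forall x, x \notin s -> f x = 0 >].

Lemma finsupp_submod : submod_closed finsupp.
Proof.
split=> [|a f g /asboolP[s fs] /asboolP[t gt]]; apply/asboolP; first by exists [::].
exists (s ++ t) => x; rewrite mem_cat negb_or => /andP[xs xt].
by rewrite /GRing.add /= /GRing.scale /= fs // gt // scaler0 addr0.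
Qed.

HB.instance Definition _ :=
  GRing.isSubmodClosed.Build R (X -> R^o) finsupp finsupp_submod.

Record freemod := Freemod { freemod_val : X -> R^o; _ : freemod_val \in finsupp }.

HB.instance Definition _ := [isSub for freemod_val].
HB.instance Definition _ := [Choice of freemod by <:].
HB.instance Definition _ := [SubChoice_isSubLmodule of freemod by <:].

Implicit Types (f g : freemod) (x y : X).

Lemma freemod_supp f : exists2 s : seq X, uniq s &
  forall x, x \notin s -> val f x = 0.
Proof.
have /asboolP[s fs] := valP f; exists (undup s); first exact: undup_uniq.
by move=> x; rewrite mem_undup; apply: fs.
Qed.

Lemma freemod_base_subproof x : (fun y => (y == x)%:R : R^o) \in finsupp.
Proof. by apply/asboolP; exists [:: x] => y; rewrite inE => /negPf ->. Qed.

Definition freemod_base x : freemod := Freemod (freemod_base_subproof x).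

Section Lift.
Variables (V : lmodType R) (v : X -> V).

(** The sum over all of [X] is a finitely supported one, so no list containing the support has to be
    chosen. *)
Definition freemod_lift f : V := \sum_(x \in [set: X]) (val f x : R) *: v x.

Lemma freemod_liftE s f : uniq s -> (forall x, x \notin s -> val f x = 0) ->
  freemod_lift f = \sum_(x <- s) (val f x : R) *: v x.
Proof.
move=> us fs; rewrite /freemod_lift (fsbigE s) // => [|x _ /fs ->].
  by apply: eq_bigl => x; rewrite in_setT.
by rewrite scale0r.
Qed.

Lemma freemod_lift_is_linear : linear freemod_lift.
Proof.
move=> a f g; have [s us fs] := freemod_supp f; have [t ut gt] := freemod_supp g.
have u_uniq := undup_uniq (s ++ t); set u := undup _ in u_uniq.
have fu x : x \notin u -> val f x = 0.
  by rewrite mem_undup mem_cat negb_or => /andP[/fs].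
have gu x : x \notin u -> val g x = 0.
  by rewrite mem_undup mem_cat negb_or => /andP[_ /gt].
rewrite !(freemod_liftE u_uniq) // => [|x xu].
  rewrite scaler_sumr -big_split /=; apply: eq_bigr => x _.
  by rewrite scalerA -scalerDl.
by rewrite linearP /= /GRing.add /= /GRing.scale /= fu // gu // scaler0 addr0.
Qed.

HB.instance Definition _ :=
  GRing.isLinear.Build R freemod V _ freemod_lift freemod_lift_is_linear.

Lemma freemod_lift_base x : freemod_lift (freemod_base x) = v x.
Proof.
rewrite (freemod_liftE (s := [:: x])) // => [|y]; last by rewrite inE => /negPf /= ->.
by rewrite big_seq1 /= eqxx scale1r.
Qed.

End Lift.

Lemma freemod_ind (S : freemod -> Prop) : S 0 ->
  (forall a f g, S f -> S g -> S (a *: f + g)) ->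
  (forall x, S (freemod_base x)) -> forall f, S f.
Proof.
move=> S0 SP Sb f; have [s us fs] := freemod_supp f.
have -> : f = \sum_(x <- s) (val f x : R) *: freemod_base x.
  apply: val_inj; rewrite raddf_sum fct_sumE; apply/funext => y.
  have [ys|ys] := boolP (y \in s); last first.
    rewrite fs // big_seq big1 // => x xs.
    rewrite /= /GRing.scale /=; case: eqP ys => [->|]; first by rewrite xs.
    by rewrite scaler0.
  rewrite (bigD1_seq y) //= big1 => [|x /negPf xy]; rewrite /GRing.scale /=.
    by rewrite eqxx addr0 [RHS]mulr1.
  by rewrite eq_sym xy scaler0.
by elim: s {us fs} => [|x s IH]; rewrite ?big_nil // big_cons; apply: SP.
Qed.

Lemma freemod_projective : projective_module freemod.
Proof.
move=> A B p f p_surj.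
pose v x := projT1 (cid (p_surj (f (freemod_base x)))).
exists (freemod_lift v).
apply: freemod_ind => [|a g h pg ph|x]; first by rewrite !linear0.
  by rewrite !linearP pg ph.
by rewrite /= freemod_lift_base /v; case: cid.
Qed.

End FreeModule.

Section ProjectiveLift.
Variable R : comPzRingType.
Implicit Types A B P M N : lmodType R.

(** Here [p] need not be surjective. Instead of cutting its target down to its image, [P] is split
    off by [s] from the free module on its own elements, where preimages are chosen one base element
    at a time. *)
Lemma projective_lift P A B (p : {linear A -> B}) (f : {linear P -> B}) :
  projective_module P -> (forall x, exists a, p a = f x) ->
  exists g : {linear P -> A}, forall x, p (g x) = f x.
Proof.
move=> projP pf.
have [|s sK] := projP (freemod R P) P (freemod_lift (V := P) id) idfun.
  by move=> x; exists (freemod_base R x); rewrite /= freemod_lift_base.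
pose v x := projT1 (cid (pf x)).
exists (freemod_lift v \o s) => x /=; rewrite -[x in RHS]sK.
elim/freemod_ind: (s x) => [|a g h pg ph|y]; first by rewrite !linear0.
  by rewrite !linearP pg ph.
by rewrite /= !freemod_lift_base /v; case: cid.
Qed.

Lemma regular_projective : projective_module (R^o : lmodType R).
Proof.
move=> A B p f /(_ (f 1))[a pa].
have a_lin : linear (fun r : R^o => (r : R) *: a).
  by move=> b x y; rewrite scalerDl scalerA.
pose g : {linear R^o -> A} := HB.pack (fun r : R^o => (r : R) *: a)
  (GRing.isLinear.Build R R^o A _ _ a_lin).
by exists g => x; rewrite /= linearZ /= pa -linearZ /= [_ *: _]mulr1.
Qed.

End ProjectiveLift.

(** * Vanishing of Ext *)

Section ExtVanishing.
Variable R : comPzRingType.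
Implicit Types M N : lmodType R.

(** [h] is a component of a homotopy between multiplication by x and 0, which both lift the zero map
    of [M]. Inductively, x - h d lands in the cycles, hence lifts through the next differential to
    the next h; composing with d removes the term h d. *)
Lemma contracting_map M (Q : resolution M) (x : R) j :
  (forall i, projective_module (Q i)) -> (forall y : M, x *: y = 0) ->
  exists h : {linear Q j -> Q j.+1},
    forall y, res_d Q j (h (res_d Q j y)) = x *: res_d Q j y.
Proof.
move=> Qproj xM; elim: j => [|j [h hP]].
  have [|h hP] := projective_lift (p := res_d Q 0)
    (f := x \*: (idfun : {linear Q 0%N -> Q 0%N})) (Qproj 0%N).
    by move=> y; apply/res_exact0; rewrite linearZ /= xM.
  by exists h => y; rewrite hP.
pose phi : {linear Q j.+1 -> Q j.+1} :=
  (x \*: (idfun : {linear Q j.+1 -> Q j.+1})) \- (h \o res_d Q j).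
have [|g gP] := projective_lift (p := res_d Q j.+1) (f := phi) (Qproj j.+1).
  by move=> y; apply/res_exact; rewrite /= linearB linearZ hP subrr.
have dd y : res_d Q j (res_d Q j.+1 y) = 0 by apply/res_exact; exists y.
by exists g => y; rewrite gP /= dd linear0 subr0.
Qed.

(* The elements x_i annihilate M, so they act on Ext(M, N) as zero; but the
   endomorphisms of N act on Ext(M, N) too, and sum_i T_i x_i is the identity. *)
Lemma Ext_eq0_annihilated M N k m (x : 'I_m -> R) (T : 'I_m -> {linear N -> N}) :
  (forall i (y : M), x i *: y = 0) ->
  (forall y, \sum_i T i (x i *: y) = y) -> (1 <= k)%N -> Ext_eq0 k M N.
Proof.
case: k => // k xM TxK _ Q Qproj f fd.
pose h i := projT1 (cid (contracting_map k Qproj (xM i))).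
have hP i y : res_d Q k (h i (res_d Q k y)) = x i *: res_d Q k y.
  by rewrite /h; case: cid.
have g_lin : linear (fun y : Q k => \sum_i T i (f (h i y))).
  move=> a y z; rewrite scaler_sumr -big_split; apply: eq_bigr => i _ /=.
  by rewrite !linearP.
pose g : {linear Q k -> N} := HB.pack (fun y : Q k => \sum_i T i (f (h i y)))
  (GRing.isLinear.Build _ _ _ _ _ g_lin).
exists g => y /=.
rewrite -[LHS]TxK; apply: eq_bigr => i _; congr (T i _).
(* The two arguments of [f] differ by a cycle, hence by a boundary, on which the cocycle [f]
   vanishes. *)
have : res_d Q k (x i *: y - h i (res_d Q k y)) = 0.
  by rewrite linearB linearZ hP subrr.
by case/res_exact=> z zP; apply/eqP; rewrite -subr_eq0 -linearZ -linearB -zP fd.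
Qed.

End ExtVanishing.

(** * Homomorphisms defined on ideals, and cyclic modules *)

Section Extension.
Variable R : comPzRingType.
Implicit Types (B N : lmodType R) (I : submodClosed R^o).

(* The graph of a homomorphism from a submodule of B to N. *)
Record partial_hom B N (F : B -> N -> Prop) : Prop := PartialHom {
  phom0 : F 0 0;
  phomP : forall c b b' y y', F b y -> F b' y' -> F (c *: b + b') (c *: y + y');
  phom_fun : forall y, F 0 y -> y = 0
}.

(** A linear map on [R^o] is multiplication by its value z at 1. *)
Definition extends N (F : R^o -> N -> Prop) :=
  exists z, forall r y, F r y -> y = (r : R) *: z.

Lemma phom_uniq B N (F : B -> N -> Prop) b y y' :
  partial_hom F -> F b y -> F b y' -> y = y'.
Proof.
case=> _ FP F0 Fy Fy'; apply/eqP; rewrite -subr_eq0; apply/eqP/F0.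
by have := FP (-1) _ _ _ _ Fy' Fy; rewrite !scaleN1r addNr addrC.
Qed.

Lemma ideal_of_phom N (F : R^o -> N -> Prop) : partial_hom F ->
  exists I, forall r, r \in I <-> exists y, F r y.
Proof.
move=> [F0 FP _]; pose D : {pred R^o} := fun r => `[< exists y, F r y >].
have D_sub : submod_closed D.
  split=> [|a r r' /asboolP[y Fy] /asboolP[y' Fy']]; apply/asboolP.
    by exists 0.
  by exists (a *: y + y'); apply: FP.
pose I : submodClosed R^o := HB.pack D (GRing.isSubmodClosed.Build R R^o D D_sub).
by exists I => r; split=> [/asboolP|Fr] //; apply/asboolP.
Qed.

Lemma pi_quot_ideal_surj I (y : quot_ideal I) : exists x, \pi_(quot_ideal I) x = y.
Proof. by exists (repr y); rewrite reprK. Qed.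

Lemma pi_quot_ideal_linear I : linear (\pi_(quot_ideal I) : R^o -> quot_ideal I).
Proof. by move=> a x y; rewrite pi_quot_idealD pi_quot_ideal_scale. Qed.

Definition pi_ideal I : {linear R^o -> quot_ideal I} :=
  HB.pack (\pi_(quot_ideal I) : R^o -> quot_ideal I)
    (GRing.isLinear.Build _ _ _ _ _ (@pi_quot_ideal_linear I)).

Lemma pi_ideal_eq0 I x : pi_ideal I x = 0 <-> x \in I.
Proof.
have -> : (x \in I) = (\pi_(quot_ideal I) x == \pi_(quot_ideal I) 0).
  by rewrite -Quotient.idealrBE subr0.
by rewrite -[0](linear0 (pi_ideal I)); split=> [/eqP|/eqP].
Qed.

Lemma scale_quot_ideal_eq0 I (x : R) (y : quot_ideal I) : x \in I -> x *: y = 0.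
Proof.
move=> xI; have [z <-] := pi_quot_ideal_surj y.
rewrite -[_ *: _](linearZ_LR (pi_ideal I)); apply/pi_ideal_eq0.
by rewrite [_ *: _]mulrC; apply: (@rpredZ _ R^o I z x).
Qed.

End Extension.

(** * Free resolutions of cyclic modules *)

Section FreeResolution.
Variable R : comPzRingType.

(** Bundling a map with its modules lets [iter] build a resolution, in which each module depends on
    the preceding map. *)
Record lmod_arrow := LmodArrow {
  arrow_src : lmodType R;
  arrow_tgt : lmodType R;
  arrow_fun : {linear arrow_src -> arrow_tgt}
}.

Section Cover.
Variables (A : lmodType R) (K : A -> Prop).

(* [freemod R A] maps onto any submodule K of A by sending the base elements
   outside K to 0. *)
Definition free_cover : {linear freemod R A -> A} :=
  freemod_lift (fun x => if `[< K x >] then x else 0).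

Lemma free_cover_base x : K x -> free_cover (freemod_base R x) = x.
Proof. by move=> Kx; rewrite /free_cover /= freemod_lift_base asboolT. Qed.

Lemma free_cover_im x : K 0 -> (forall a y z, K y -> K z -> K (a *: y + z)) ->
  K x <-> exists y, free_cover y = x.
Proof.
move=> K0 KP; split=> [Kx|[y <-]].
  by exists (freemod_base R x); apply: free_cover_base.
elim/freemod_ind: y => [|a f g Kf Kg|y]; rewrite ?linear0 ?linearP; auto.
by rewrite /free_cover /= freemod_lift_base; case: asboolP.
Qed.

End Cover.

Definition arrow_cover (s : lmod_arrow) : lmod_arrow :=
  LmodArrow (free_cover (fun x => arrow_fun s x = 0)).

Section QuotIdeal.
Variable I : submodClosed R^o.

Definition free_arrow (i : nat) : lmod_arrow :=
  iter i arrow_cover (LmodArrow (free_cover (fun x : (R^o : lmodType R) => x \in I))).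

Lemma free_arrow_exact0 (x : R^o) :
  pi_ideal I x = 0 <-> exists y, arrow_fun (free_arrow 0) y = x.
Proof.
rewrite pi_ideal_eq0 /=.
by apply: free_cover_im => [|a y z Iy Iz]; rewrite ?rpred0 ?rpredD ?rpredZ.
Qed.

Lemma free_arrow_exact i (x : arrow_src (free_arrow i)) :
  arrow_fun (free_arrow i) x = 0 <->
  exists y : freemod R (arrow_src (free_arrow i)),
    arrow_fun (arrow_cover (free_arrow i)) y = x.
Proof.
apply: free_cover_im => [|a y z y0 z0]; first by rewrite linear0.
by rewrite linearP y0 z0 scaler0 addr0.
Qed.

(** Consecutive differentials compose because the target of [free_arrow i.+1] is, by conversion, the
    source of [free_arrow i]. *)
Definition quot_ideal_resolution : resolution (quot_ideal I) :=
  Resolution (res_obj := fun i => arrow_tgt (free_arrow i))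
    (res_d := fun i => arrow_fun (free_arrow i)) (res_eps := pi_ideal I)
    (@pi_quot_ideal_surj R I) free_arrow_exact0 free_arrow_exact.

Lemma quot_ideal_resolution_projective i :
  projective_module (quot_ideal_resolution i).
Proof.
by case: i => [|[|i]]; [apply: regular_projective | apply: freemod_projective..].
Qed.

End QuotIdeal.

(** [F] composed with the free cover of [I] is the 1-cochain [freemod_lift v]. It is a cocycle: the
    next differential lands in the kernel of the cover, and [F] takes only the value 0 at 0. As a
    coboundary it is some g after the cover, and z = g(1). *)
Lemma Ext_eq0_extends (N : lmodType R) (F : R^o -> N -> Prop) (I : submodClosed R^o) :
  partial_hom F -> (forall r, r \in I <-> exists y, F r y) ->
  Ext_eq0 1 (quot_ideal I) N -> extends F.
Proof.
move=> homF domF ext0.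
(* The default 0 matches that of [free_cover], so that [vP] also holds for base elements outside
   [I]. *)
pose v (r : R^o) : N := if pselect (exists y, F r y) is left e then projT1 (cid e) else 0.
have Fv r : r \in I -> F r (v r).
  by move=> /domF Fr; rewrite /v; case: pselect => // e; case: cid.
have vP w : F (free_cover (fun x => x \in I) w) (freemod_lift v w).
  elim/freemod_ind: w => [|a f g Ff Fg|x].
  - by rewrite !linear0; case: homF.
  - by rewrite !linearP; case: homF => _ FP _; apply: FP.
  - rewrite /free_cover /= !freemod_lift_base; case: asboolP => [/Fv //|xI].
    by rewrite /v; case: pselect => [/domF //|_]; case: homF.
have [|g gP] := ext0 _ (@quot_ideal_resolution_projective I) (freemod_lift v).
  move=> x; apply: phom_fun homF _ _.
  have := vP (res_d (quot_ideal_resolution I) 1 x).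
  suff -> : free_cover (fun x => x \in I) (res_d (quot_ideal_resolution I) 1 x) = 0.
    by [].
  by apply/(@res_exact _ _ (quot_ideal_resolution I) 0); exists x.
exists (g 1) => r y Fry; have rI : r \in I by apply/domF; exists y.
have := gP (freemod_base R (r : R^o)); rewrite /= freemod_lift_base.
rewrite [freemod_lift _ _](free_cover_base rI) => vr.
rewrite -linearZ [_ *: _]mulr1 -vr; exact: phom_uniq homF Fry (Fv _ rI).
Qed.

End FreeResolution.

(** * Baer's criterion *)

(** [Zorn_bigcup] also requires the empty chain and gives no lower bound. Both are settled by
    applying it to the sets whose union with [A0] satisfies [P]. *)
Lemma Zorn_above T (P : set (set T)) (A0 : set T) : P A0 ->
  (forall C : set (set T), (C !=set0)%classic -> (C `<=` P)%classic ->
    total_on C subset -> P (\bigcup_(X in C) X)%classic) ->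
  exists A, [/\ (A0 `<=` A)%classic, P A &
    forall B, (A `<=` B)%classic -> P B -> (B `<=` A)%classic].
Proof.
move=> PA0 PC; have [C CP Ctot|A [PA maxA]] :=
  @Zorn_bigcup T (fun B => P (A0 `|` B)%classic).
  have [->|/set0P[X0 CX0]] := eqVneq C set0; first by rewrite bigcup_set0 setU0.
  rewrite [X in P X](_ : _ = \bigcup_(Y in [set A0 `|` X | X in C]) Y)%classic.
    apply: PC => [|_ [X /CP PX <-]//|_ _ [X CX <-] [Y CY <-]].
      by exists (A0 `|` X0)%classic; exists X0.
    by have [|] := Ctot _ _ CX CY; [left|right]; apply: setUS.
  by rewrite bigcup_image -bigcupUr //; exists X0.
exists (A0 `|` A)%classic; split=> [||B AB PB]; [exact: subsetUl | by [] |].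
apply: contrapT => nBA; apply: (maxA B).
  split=> [|BA]; last by apply: nBA => x /BA; right.
  by move=> x Ax; apply: AB; right.
by rewrite [X in P X](_ : _ = B) // setUidPr // => x A0x; apply: AB; left.
Qed.

Section Baer.
Variables (R : comPzRingType) (N : lmodType R).
Hypothesis N_inj : forall F : R^o -> N -> Prop, partial_hom F -> extends F.

(** Let [A] be a maximal graph above [G]. For any b, the map sending r to the value of [A] at r b is
    defined on an ideal, so it is multiplication by some z; adjoining (b, z) to [A] gives a graph
    again, and by maximality [A] is defined at b. *)
Lemma Baer (B : lmodType R) (G : B -> N -> Prop) : partial_hom G ->
  exists g : {linear B -> N}, forall b y, G b y -> y = g b.
Proof.
move=> homG.
have [//|C [X0 CX0] CP Ctot|A [GA homA maxA]] := @Zorn_above (B * N)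
    (fun S => partial_hom (fun b y => S (b, y))) (fun p => G p.1 p.2).
  split=> [|c b b' y y' [X CX Xb] [X' CX' Xb']|y [X CX]].
  - by exists X0 => //; apply: phom0 (CP _ CX0).
  - have [XX'|X'X] := Ctot _ _ CX CX'.
      by exists X' => //; apply: (phomP (CP _ CX')) => //; apply: XX'.
    by exists X => //; apply: (phomP (CP _ CX)) => //; apply: X'X.
  - exact: phom_fun (CP _ CX) _.
have tot b : exists y, A (b, y).
  have [|z zP] := N_inj (F := fun r y => A ((r : R) *: b, y)).
    split=> [|c r r' y y' Ar Ar'|y]; first by rewrite scale0r; apply: phom0 homA.
      by rewrite scalerDl -scalerA; apply: (phomP homA).
    by rewrite scale0r; apply: phom_fun homA _.
  pose A' := [set p | exists r b' y', A (b', y') /\ p = (b' + r *: b, y' + r *: z)]%classic.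
  exists z; apply: (maxA A') => [[b' y'] Ab'||].
  - by exists 0, b', y'; rewrite !scale0r !addr0.
  - split=> [|c b1 b2 y1 y2|y].
    + by exists 0, 0, 0; rewrite !scale0r !addr0; split=> //; apply: phom0 homA.
    + case=> [r1 [b1' [y1' [A1 [-> ->]]]]] [r2 [b2' [y2' [A2 [-> ->]]]]].
      exists (c * r1 + r2), (c *: b1' + b2'), (c *: y1' + y2').
      split; first exact: (phomP homA).
      by congr (_, _); rewrite scalerDr scalerDl -scalerA addrACA.
    (* Here b' = - r b, so the choice of z forces y' = - r z. *)
    + case=> [r [b' [y' [Ab' [/esym/eqP]]]]]; rewrite addr_eq0 => /eqP b'E ->.
      rewrite (zP (- r) y'); first by rewrite scaleNr addNr.
      by rewrite scaleNr -b'E.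
  - by exists 1, 0, 0; rewrite !add0r !scale1r; split=> //; apply: phom0 homA.
pose g b := projT1 (cid (tot b)).
have Ag b : A (b, g b) by rewrite /g; case: cid.
have g_lin : linear g.
  by move=> a x y; apply: phom_uniq homA (Ag _) (phomP homA _ (Ag x) (Ag y)).
pose gl : {linear B -> N} := HB.pack g (GRing.isLinear.Build _ _ _ _ _ g_lin).
by exists gl => b y Gby; apply: phom_uniq homA (GA (b, y) Gby) (Ag b).
Qed.

End Baer.

(** * Semisimplicity as injectivity of strongly Lucas modules *)

Section SemisimpleExtends.
Variable R : comPzRingType.

Lemma tauq_semisimple_extends : tauq_semisimple R <->
  forall N : lmodType R, strongly_Lucas N ->
  forall F : R^o -> N -> Prop, partial_hom F -> extends F.
Proof.
split=> [/tauq_semisimpleP ss N NL F homF|N_inj].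
  have [I domF] := ideal_of_phom homF.
  exact: Ext_eq0_extends homF domF (ss _ _ NL).
apply/tauq_semisimpleP => M N NL Q Qproj f fd.
(* By exactness the cocycle [f] factors through the image of the differential in [Q 0]; extending
   this factor to [Q 0] makes [f] a coboundary. *)
have [|g gP] := Baer (N_inj N NL) (G := fun b y => exists2 x, res_d Q 0 x = b & f x = y).
  split=> [|c b b' y y' [x <- <-] [x' <- <-]|y [x /res_exact[z <-] <-]].
  - by exists 0; rewrite linear0.
  - by exists (c *: x + x'); rewrite linearP.
  - exact: fd.
by exists g => x; apply: gP; exists x.
Qed.

End SemisimpleExtends.

(** * Finite intersections of primes *)

Record prime_ideal (R : comPzRingType) (P : R -> Prop) : Prop := PrimeIdeal {
  prime_ideal0 : P 0;
  prime_idealD : forall x y, P x -> P y -> P (x + y);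
  prime_idealM : forall a x, P x -> P (a * x);
  prime_ideal1 : ~ P 1;
  prime_ideal_or : forall x y, P (x * y) -> P x \/ P y
}.

(** The empty family, m = 0, accounts for the zero ring. *)
Definition finite_prime_inter (R : comPzRingType) :=
  exists m (P : 'I_m -> R -> Prop),
    (forall i, prime_ideal (P i)) /\ forall x, (forall i, P i x) -> x = 0.

Section PrimeIntersection.
Variable R : comPzRingType.

Lemma prime_ideal_sum (P : R -> Prop) (I : Type) (s : seq I) (A : pred I) (f : I -> R) :
  prime_ideal P -> (forall i, A i -> P (f i)) -> P (\sum_(i <- s | A i) f i).
Proof. by case=> P0 PD _ _ _ Pf; apply: big_ind. Qed.

Lemma irredundant_prime_inter : finite_prime_inter R ->
  exists m (P : 'I_m -> R -> Prop) (c : 'I_m -> R),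
  [/\ forall i, prime_ideal (P i), forall x, (forall i, P i x) -> x = 0 &
      forall i, ~ P i (c i) /\ forall j, j != i -> P j (c i)].
Proof.
case=> m; elim: m => [|m IH] [P [Pprime P0]].
  by exists 0%N, P, (fun=> 0); split=> // -[].
have [c_ex|] := pselect (forall i, exists c, ~ P i c /\ forall j, j != i -> P j c).
  by exists m.+1, P, (fun i => projT1 (cid (c_ex i))); split=> // i; case: cid.
move=> /existsNP[i /forallNP noc]; apply: IH; exists (fun j => P (lift i j)); split=> // x Px.
apply: P0 => j; have [k ->|->] := unliftP i j; first exact: Px.
apply: contrapT => nPx; apply: (noc x); split=> // k; rewrite eq_sym => /unlift_some[l -> _].
exact: Px.
Qed.

(** [a] collects the primes not containing [J], and [b] those containing it. Modulo [P i] only the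
    i-th term of a + b survives, and it is nonzero; so a + b lies outside every [P i] and is
    regular. *)
Lemma regular_of_ideal : finite_prime_inter R ->
  forall J : submodClosed R^o, exists a b : R,
  [/\ a \in J, forall x, x \in J -> b * x = 0 & forall x, (a + b) * x = 0 -> x = 0].
Proof.
move=> /irredundant_prime_inter[m [P [c [Pprime P0 cP]]]] J.
pose out i := `[< exists x, x \in J /\ ~ P i x >].
pose d i := if pselect (exists x, x \in J /\ ~ P i x) is left e then projT1 (cid e) else 0.
have dJ i : out i -> d i \in J /\ ~ P i (d i).
  by move=> /asboolP oi; rewrite /d; case: pselect => // e; case: cid.
have inJ i x : ~~ out i -> x \in J -> P i x.
  by move=> /asboolP oi xJ; apply: contrapT => nPx; apply: oi; exists x.
exists (\sum_(i | out i) c i * d i), (\sum_(i | ~~ out i) c i); split.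
- by apply: rpred_sum => i /dJ[di _]; apply: (@rpredZ _ R^o).
- move=> x xJ; rewrite mulr_suml big1 // => i oi; apply: P0 => j.
  have [->|ji] := eqVneq j i; first by apply: prime_idealM => //; apply: inJ oi xJ.
  by rewrite mulrC; apply: prime_idealM => //; case: (cP i) => _; apply.
pose e i := if out i then d i else 1.
have -> : \sum_(i | out i) c i * d i + \sum_(i | ~~ out i) c i = \sum_i c i * e i.
  rewrite [RHS](bigID out) /=; congr (_ + _); apply: eq_bigr => i oi.
    by rewrite /e oi.
  by rewrite /e (negPf oi) mulr1.
move=> x sx0; apply: P0 => i; have Pi := Pprime i.
have [|//] : P i (c i * e i) \/ P i x; last first.
  move=> /(prime_ideal_or Pi)[] // Pe; first by case: (cP i).
  by move: Pe; rewrite /e; case: ifP => [/dJ[]|_ /(prime_ideal1 Pi)].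
apply: (prime_ideal_or Pi); move: sx0; rewrite (bigD1 i) //= mulrDl => /eqP.
rewrite addr_eq0 => /eqP ->; rewrite -mulN1r; apply: (prime_idealM Pi).
rewrite mulrC; apply: (prime_idealM Pi); apply: prime_ideal_sum => // j ji.
by rewrite mulrC; apply: (prime_idealM Pi); case: (cP j) => _; apply; rewrite eq_sym.
Qed.

Lemma principal_phom (N : lmodType R) (s : R) (y : N) :
  (forall x, s * x = 0 -> x *: y = 0) ->
  partial_hom (fun (r : R^o) z => exists2 c : R, r = c * s & z = c *: y).
Proof.
move=> sy; split=> [|a r r' z z' [c -> ->] [c' -> ->]|z [c /esym]].
- by exists 0; rewrite ?mul0r ?scale0r.
- by exists (a * c + c'); rewrite ?mulrDl ?scalerDl -?mulrA -?scalerA.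
- by rewrite mulrC => /sy cy ->.
Qed.

(** * Regular elements acting on strongly Lucas modules *)

Section StronglyLucas.
Variables (N : lmodType R) (s : R).
Hypotheses (NL : strongly_Lucas N) (s_reg : forall x, s * x = 0 -> x = 0).

Lemma regular_phom (y : N) :
  partial_hom (fun (r : R^o) z => exists2 c : R, r = c * s & z = c *: y).
Proof. by apply: principal_phom => x /s_reg ->; rewrite scale0r. Qed.

Lemma calQ_principal (I : submodClosed R^o) :
  (forall r, r \in I <-> exists c : R, r = c * s) -> calQ I.
Proof.
move=> IP; have sI : s \in I by apply/IP; exists 1; rewrite mul1r.
have fgI : fg_ideal I.
  exists [:: s] => r; rewrite IP; split=> [[c ->]|[c ->]].
    by exists (fun=> c); rewrite big_ord_recl big_ord0 addr0.
  by exists (c ord0); rewrite big_ord_recl big_ord0 addr0.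
by split=> //; exists I; split=> // r /(_ s sI)/s_reg.
Qed.

Lemma principal_ideal : exists2 I : submodClosed R^o, calQ I &
  forall r, r \in I <-> exists c : R, r = c * s.
Proof.
(* The ideal generated by s is obtained as the domain of the zero map on it. *)
have [I IP] := ideal_of_phom (regular_phom 0); exists I.
  apply: calQ_principal => r; rewrite IP; split=> [[_ [c -> _]]|[c ->]]; first by exists c.
  by exists (c *: 0), c.
by move=> r; rewrite IP; split=> [[_ [c -> _]]|[c ->]]; [exists c | exists (c *: 0), c].
Qed.

Lemma strongly_Lucas_regular_inj (y : N) : s *: y = 0 -> y = 0.
Proof.
move=> sy0; have [I IQ IP] := principal_ideal; apply: NL.1 IQ _ _ => r /IP[c ->].
by rewrite -scalerA sy0 scaler0.
Qed.

Lemma strongly_Lucas_regular_surj (y : N) : exists z, y = s *: z.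
Proof.
have [I IQ IP] := principal_ideal.
have [|z zP] := Ext_eq0_extends (regular_phom y) _ (NL.2 I IQ 1 isT).
  move=> r; rewrite IP; split=> [[c ->]|[_ [c -> _]]]; last by exists c.
  by exists (c *: y), c.
by exists z; apply: zP; exists 1; rewrite ?mul1r ?scale1r.
Qed.

End StronglyLucas.

Lemma finite_prime_inter_semisimple : finite_prime_inter R -> tauq_semisimple R.
Proof.
move=> Rfin; apply/tauq_semisimple_extends => N NL F homF.
have [J JP] := ideal_of_phom homF.
have [a [b [aJ bJ s_reg]]] := regular_of_ideal Rfin J.
have [ya Fa] := (JP a).1 aJ.
(* z is F(a) / (a + b). The regular element a + b sends y - r z to a y - r F(a) = 0, because b kills
   y. *)
have [z zP] := strongly_Lucas_regular_surj NL s_reg ya.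
have FZ c r y : F r y -> F (c * r) (c *: y).
  by move=> Fry; have := phomP homF c Fry (phom0 homF); rewrite !addr0.
exists z => r y Fry; have rJ : r \in J by apply/JP; exists y.
have ay : a *: y = r *: ya.
  by apply: phom_uniq homF (FZ a _ _ Fry) _; rewrite mulrC; apply: FZ.
have by0 : b *: y = 0.
  by apply: (phom_fun homF); rewrite -(bJ r rJ); apply: FZ.
apply/eqP; rewrite -subr_eq0; apply/eqP/(strongly_Lucas_regular_inj NL s_reg).
by rewrite scalerBr scalerDl by0 addr0 ay scalerA mulrC -scalerA -zP subrr.
Qed.

End PrimeIntersection.

(** * Prime ideals of power series rings *)

Section PowerSeries.
Variables (n : nat) (R : comPzRingType).
Implicit Types (f g : mpowser n R) (m : 'X_{1..n}).

Definition mpowser_const (c : R) : mpowser n R := fun m => if m == 0%MM then c else 0.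

Lemma mpowser_constM c g m : (mpowser_const c * g) m = c * g m.
Proof.
rewrite [LHS](mpowser_mulE _ _ (ltnSn _)) (bigD1 bm0) /=; last first.
  by apply/mnm_lepP => i; rewrite mnm0E.
rewrite /mpowser_const eqxx subm0 big1 ?addr0 // => k /andP[_].
by rewrite bmeqP /= => /negPf ->; rewrite mul0r.
Qed.

Lemma prime_ideal_contract (P : mpowser n R -> Prop) :
  prime_ideal P -> prime_ideal (fun c => P (mpowser_const c)).
Proof.
have constM a b : mpowser_const (a * b) = mpowser_const a * mpowser_const b.
  apply/funext => m; rewrite mpowser_constM /mpowser_const.
  by case: eqP; rewrite ?mulr0.
case=> P0 PD PM P1 P_or; split=> [|a b Pa Pb|a b Pb|Pc1|a b].
- suff -> : mpowser_const 0 = 0 by [].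
  by apply/funext => m; rewrite /mpowser_const if_same.
- suff -> : mpowser_const (a + b) = mpowser_const a + mpowser_const b by apply: PD.
  apply/funext => m; rewrite /GRing.add /= /mpowser_const.
  by case: eqP; rewrite ?addr0.
- by rewrite constM; apply: (PM).
- apply: P1; suff -> : 1 = mpowser_const 1 by [].
  by apply/funext => m; rewrite /GRing.one /= /mpowser1 /mpowser_const; case: eqP.
- by rewrite constM; apply: P_or.
Qed.

Lemma minimal_monomial (A : 'X_{1..n} -> Prop) : (exists m, A m) ->
  exists2 m, A m & forall k, (k < m)%O -> ~ A k.
Proof.
case=> m; elim/(well_founded_ind (@ltom_wf n)): m => m IH Am.
have [[k [km Ak]]|nk] := pselect (exists k, (k < m)%O /\ A k); first exact: IH km Ak.
by exists m => // k km Ak; apply: nk; exists k.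
Qed.

(** As in Gauss's lemma, take the least monomials m1 of f and m2 of g with coefficients outside [P].
    If k1 + k2 = m1 + m2 is another decomposition, then k1 < m1 or k2 < m2, so its term is in [P];
    hence so is the product of the two chosen coefficients. *)
Lemma prime_ideal_mpowser (P : R -> Prop) :
  prime_ideal P -> prime_ideal (fun f : mpowser n R => forall m, P (f m)).
Proof.
move=> Pprime; have [P0 PD PM P1 P_or] := Pprime.
split=> [m|f g Pf Pg m|f g Pg m|/(_ 0%MM)|f g Pfg].
- exact: P0.
- by apply: PD.
- by apply: prime_ideal_sum => // k _; apply: (PM).
- by rewrite /GRing.one /= /mpowser1 eqxx.
apply: contrapT => /not_orP[/existsNP/minimal_monomial[m1 f1 m1_min]].
move=> /existsNP/minimal_monomial[m2 g2 m2_min].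
have [|//|//] := P_or (f m1) (g m2).
have lt1 : (mdeg m1 < (mdeg (m1 + m2)).+1)%N by rewrite ltnS mdegD leq_addr.
have lt2 : (mdeg m2 < (mdeg (m1 + m2)).+1)%N by rewrite ltnS mdegD leq_addl.
have := Pfg (m1 + m2)%MM; rewrite {1}/GRing.mul /= /mpowser_mul.
rewrite (bigD1 (BMultinom lt1, BMultinom lt2)) //=; set S := \sum_(k | _) _ => Pfg12.
rewrite -[_ * _](addrK S) -mulN1r; apply: (PD) => //; apply: (PM).
apply: prime_ideal_sum => // -[[k1 ?] [k2 ?]] /= /andP[/eqP k12].
rewrite xpair_eqE !bmeqP /= negb_and => k_neq.
have [lt_k1|k1_ge] := ltP k1 m1.
  by rewrite mulrC; apply: (PM); apply: contrapT; apply: m1_min lt_k1.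
have lt_k2 : (k2 < m2)%O.
  rewrite ltNge; apply/negP => le_m2; move: k_neq.
  move: (k1_ge) (le_m2); rewrite !le_eqVlt => /predU1P[<-|lt1'] /predU1P[<-|lt2'].
  - by rewrite !eqxx.
  - by have := lemc_lt_add k1_ge lt2'; rewrite k12 ltxx.
  - by have := ltmc_le_add lt1' le_m2; rewrite k12 ltxx.
  - by have := ltmc_le_add lt1' le_m2; rewrite k12 ltxx.
by apply: (PM); apply: contrapT; apply: m2_min lt_k2.
Qed.

Lemma finite_prime_inter_mpowser :
  finite_prime_inter R <-> finite_prime_inter (mpowser n R).
Proof.
split=> -[r [P [Pprime P0]]]; exists r.
  exists (fun i f => forall m, P i (f m)); split=> [i|f Pf].
    exact: prime_ideal_mpowser.
  by apply/funext => m; apply: P0 => i; apply: Pf.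
exists (fun i c => P i (mpowser_const c)); split=> [i|c Pc].
  exact: prime_ideal_contract.
by have /(congr1 (fun f => f 0%MM)) := P0 _ Pc; rewrite /mpowser_const eqxx.
Qed.

End PowerSeries.

(** * Direct sums of fraction fields *)

Section FractionSum.
Variables (R : comPzRingType) (P : nat -> R -> Prop).
Hypothesis Pprime : forall j, prime_ideal (P j).

Let P0 j := prime_ideal0 (Pprime j).
Let PD j := prime_idealD (Pprime j).
Let PM j := prime_idealM (Pprime j).

Lemma prime_ideal_notM j x y : ~ P j x -> ~ P j y -> ~ P j (x * y).
Proof. by move=> nx ny /(prime_ideal_or (Pprime j))[]. Qed.

(* Representatives of the direct sum of the fraction fields of the R/P_j:
   families of numerators, almost all zero, and of denominators. *)
Definition frac_pred : pred ((nat -> R) * (nat -> R)) := fun u =>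
  `[< (forall j, ~ P j (u.2 j)) /\ exists n, forall j, (n <= j)%N -> P j (u.1 j) >].

Definition frac := {u | frac_pred u}.
Implicit Types u v w : frac.
Definition num u := (val u).1.
Definition den u := (val u).2.

Lemma den_notin u j : ~ P j (den u j).
Proof. by have /asboolP[] := valP u. Qed.

Lemma num_fin u : exists n, forall j, (n <= j)%N -> P j (num u j).
Proof. by have /asboolP[] := valP u. Qed.

Definition frac_rel u v := `[< forall j, P j (num u j * den v j - num v j * den u j) >].

Lemma frac_rel_refl : reflexive frac_rel.
Proof. by move=> u; apply/asboolP => j; rewrite subrr. Qed.

Lemma frac_rel_symW u v : frac_rel u v -> frac_rel v u.
Proof. by move=> /asboolP uv; apply/asboolP => j; rewrite -opprB -mulN1r; apply: (PM). Qed.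

Lemma frac_rel_sym : ssrbool.symmetric frac_rel.
Proof. by move=> u v; apply/idP/idP; apply: frac_rel_symW. Qed.

Lemma frac_rel_trans : transitive frac_rel.
Proof.
move=> v u w /asboolP uv /asboolP vw; apply/asboolP => j.
have : P j (den v j * (num u j * den w j - num w j * den u j)).
  rewrite (_ : _ * _ = den w j * (num u j * den v j - num v j * den u j) +
    den u j * (num v j * den w j - num w j * den v j)); last by ring.
  by apply: (PD); apply: (PM).
by case/(prime_ideal_or (Pprime j)) => // /den_notin.
Qed.

Canonical frac_equiv := EquivRel frac_rel frac_rel_refl frac_rel_sym frac_rel_trans.

Definition fracsum := {eq_quot frac_equiv}.
HB.instance Definition _ := Choice.on fracsum.
HB.instance Definition _ := EqQuotient.on fracsum.

(** Cross-multiplied equality in [R] itself, rather than modulo each [P j], suffices for the module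
    axioms and is within reach of [ring]. *)
Lemma pi_fracP u v : (forall j, num u j * den v j = num v j * den u j) ->
  \pi_fracsum u = \pi_fracsum v.
Proof.
by move=> uv; apply/eqmodP/asboolP => j; rewrite uv subrr; apply: P0.
Qed.

Lemma frac_add_subproof u v :
  frac_pred (fun j => num u j * den v j + num v j * den u j, fun j => den u j * den v j).
Proof.
apply/asboolP; split=> [j|] /=; first exact: prime_ideal_notM (@den_notin _ _) (@den_notin _ _).
have [m um] := num_fin u; have [n vn] := num_fin v; exists (maxn m n) => j.
by rewrite geq_max => /andP[/um Pu /vn Pv]; apply: (PD); rewrite mulrC; apply: (PM).
Qed.

Lemma frac_scale_subproof (a : R) u : frac_pred (fun j => a * num u j, den u).
Proof.
apply/asboolP; split=> [j|] /=; first exact: den_notin.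
by have [m um] := num_fin u; exists m => j /um; apply: (PM).
Qed.

Lemma frac_int_subproof (c : nat -> R) :
  (exists n, forall j, (n <= j)%N -> P j (c j)) -> frac_pred (c, fun=> 1).
Proof. by move=> c_fin; apply/asboolP; split=> // j; apply: prime_ideal1. Qed.

Lemma frac_zero_fin : exists n, forall j, (n <= j)%N -> P j 0.
Proof. by exists 0%N => j _; apply: P0. Qed.

Definition frac_add u v : frac := exist frac_pred _ (frac_add_subproof u v).
Definition frac_scale a u : frac := exist frac_pred _ (frac_scale_subproof a u).
Definition frac_int c c_fin : frac := exist frac_pred _ (@frac_int_subproof c c_fin).

Lemma num_add u v j : num (frac_add u v) j = num u j * den v j + num v j * den u j.
Proof. by []. Qed.
Lemma den_add u v j : den (frac_add u v) j = den u j * den v j.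
Proof. by []. Qed.
Lemma num_scale a u j : num (frac_scale a u) j = a * num u j.
Proof. by []. Qed.
Lemma den_scale a u j : den (frac_scale a u) j = den u j.
Proof. by []. Qed.
Lemma num_int c c_fin j : num (@frac_int c c_fin) j = c j.
Proof. by []. Qed.
Lemma den_int c c_fin j : den (@frac_int c c_fin) j = 1.
Proof. by []. Qed.

Definition fracE :=
  (num_add, den_add, num_scale, den_scale, num_int, den_int).

Definition fracsum_add (y z : fracsum) : fracsum :=
  \pi_fracsum (frac_add (repr y) (repr z)).
Definition fracsum_scale a (y : fracsum) : fracsum :=
  \pi_fracsum (frac_scale a (repr y)).
Definition fracsum_zero : fracsum := \pi_fracsum (frac_int frac_zero_fin).

Lemma frac_rel_repr u j :
  P j (num (repr (\pi_fracsum u)) j * den u j - num u j * den (repr (\pi_fracsum u)) j).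
Proof. by have /eqmodP/asboolP := reprK (\pi_fracsum u). Qed.

Lemma pi_frac_add u v :
  fracsum_add (\pi_fracsum u) (\pi_fracsum v) = \pi_fracsum (frac_add u v).
Proof.
apply/eqmodP/asboolP => j; rewrite !fracE.
have := frac_rel_repr u j; have := frac_rel_repr v j.
set u' := repr (\pi_fracsum u); set v' := repr (\pi_fracsum v) => Pv Pu.
rewrite (_ : _ - _ = den v j * den v' j * (num u' j * den u j - num u j * den u' j) +
  den u j * den u' j * (num v' j * den v j - num v j * den v' j)); last by ring.
by apply: (PD); apply: (PM).
Qed.

Lemma pi_frac_scale a u : fracsum_scale a (\pi_fracsum u) = \pi_fracsum (frac_scale a u).
Proof.
apply/eqmodP/asboolP => j; rewrite !fracE.
by rewrite -!mulrA -mulrBr; apply: (PM); apply: frac_rel_repr.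
Qed.

Lemma fracsum_ind (S : fracsum -> Prop) : (forall u, S (\pi_fracsum u)) -> forall y, S y.
Proof. by move=> Su y; rewrite -[y]reprK; apply: Su. Qed.

Lemma fracsum_addA : associative fracsum_add.
Proof.
elim/fracsum_ind => u; elim/fracsum_ind => v; elim/fracsum_ind => w.
rewrite !pi_frac_add; apply: pi_fracP => j.
by rewrite !fracE; ring.
Qed.

Lemma fracsum_addC : commutative fracsum_add.
Proof.
elim/fracsum_ind => u; elim/fracsum_ind => v.
rewrite !pi_frac_add; apply: pi_fracP => j.
by rewrite !fracE; ring.
Qed.

Lemma fracsum_add0 : left_id fracsum_zero fracsum_add.
Proof.
elim/fracsum_ind => u; rewrite pi_frac_add; apply: pi_fracP => j.
by rewrite !fracE; ring.
Qed.

Lemma fracsum_addN : left_inverse fracsum_zero (fracsum_scale (-1)) fracsum_add.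
Proof.
elim/fracsum_ind => u; rewrite pi_frac_scale pi_frac_add; apply: pi_fracP => j.
by rewrite !fracE; ring.
Qed.

HB.instance Definition _ :=
  GRing.isZmodule.Build fracsum fracsum_addA fracsum_addC fracsum_add0 fracsum_addN.

Lemma fracsum_scaleA a b y :
  fracsum_scale a (fracsum_scale b y) = fracsum_scale (a * b) y.
Proof.
elim/fracsum_ind: y => u; rewrite !pi_frac_scale; apply: pi_fracP => j.
by rewrite !fracE; ring.
Qed.

Lemma fracsum_scale1 : left_id 1 fracsum_scale.
Proof.
elim/fracsum_ind => u; rewrite pi_frac_scale; apply: pi_fracP => j.
by rewrite !fracE; ring.
Qed.

Lemma fracsum_scaleDr : right_distributive fracsum_scale +%R.
Proof.
move=> a; elim/fracsum_ind => u; elim/fracsum_ind => v.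
rewrite [_ + _]pi_frac_add !pi_frac_scale [RHS]pi_frac_add; apply: pi_fracP => j.
by rewrite !fracE; ring.
Qed.

Lemma fracsum_scaleDl y : {morph fracsum_scale^~ y : a b / a + b}.
Proof.
elim/fracsum_ind: y => u a b; rewrite !pi_frac_scale [RHS]pi_frac_add.
apply: pi_fracP => j.
by rewrite !fracE; ring.
Qed.

HB.instance Definition _ := GRing.Zmodule_isLmodule.Build R fracsum
  fracsum_scaleA fracsum_scale1 fracsum_scaleDr fracsum_scaleDl.

(** Vanishing of the j-th component; [zero_at_pi] gives independence of the representative. *)
Definition zero_at (y : fracsum) j := P j (num (repr y) j).

Lemma zero_at_pi u j : zero_at (\pi_fracsum u) j <-> P j (num u j).
Proof.
rewrite /zero_at; have := frac_rel_repr u j; have := @den_notin u j.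
move: (@den_notin (repr (\pi_fracsum u)) j); set v := repr _ => nv nu uv.
split=> [Pv|Pu].
  have [] // := prime_ideal_or (Pprime j) (x := num u j) (y := den v j).
  rewrite (_ : _ * _ = den u j * num v j +
    (-1) * (num v j * den u j - num u j * den v j)); last by ring.
  by apply: (PD); apply: (PM).
have [] // := prime_ideal_or (Pprime j) (x := num v j) (y := den u j).
rewrite (_ : _ * _ = den v j * num u j + (num v j * den u j - num u j * den v j)); last by ring.
by apply: (PD) => //; apply: (PM).
Qed.

Lemma zero_at_eq0 y : (forall j, zero_at y j) -> y = 0.
Proof.
elim/fracsum_ind: y => u Pu; apply/eqmodP/asboolP => j; rewrite !fracE.
by rewrite mulr1 mul0r subr0; apply/zero_at_pi.
Qed.

Lemma zero_at0 j : zero_at 0 j.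
Proof. by apply/zero_at_pi; rewrite fracE. Qed.

Lemma zero_atD y z j : zero_at y j -> zero_at z j -> zero_at (y + z) j.
Proof.
elim/fracsum_ind: y => u; elim/fracsum_ind: z => v /zero_at_pi Pu /zero_at_pi Pv.
rewrite [_ + _]pi_frac_add; apply/zero_at_pi; rewrite !fracE.
by apply: (PD); rewrite mulrC; apply: (PM).
Qed.

Lemma zero_atZ (a : R) (y : fracsum) j : P j a \/ zero_at y j -> zero_at (a *: y) j.
Proof.
elim/fracsum_ind: y => u Pau.
rewrite [_ *: _]pi_frac_scale; apply/zero_at_pi; rewrite !fracE.
by case: Pau => [Pa|/zero_at_pi Pu]; [rewrite mulrC|]; apply: (PM).
Qed.

Lemma zero_at_fin y : exists n, forall j, (n <= j)%N -> zero_at y j.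
Proof.
elim/fracsum_ind: y => u; have [n un] := num_fin u.
by exists n => j /un Pu; apply/zero_at_pi.
Qed.

Section Divide.
Variables (D : pred nat) (x : R).
Hypothesis xD : forall j, D j -> ~ P j x.

(** Division by x on the components in [D], where x is invertible, and 0 on the others. *)
Lemma frac_divide_subproof u :
  frac_pred (fun j => if D j then num u j else 0,
             fun j => if D j then x * den u j else 1).
Proof.
apply/asboolP; split=> [j|] /=.
  case: ifP => [/xD nx|_]; last exact: prime_ideal1.
  exact: prime_ideal_notM nx (@den_notin _ _).
by have [n un] := num_fin u; exists n => j /un; case: ifP.
Qed.

Definition frac_divide u : frac := exist frac_pred _ (frac_divide_subproof u).

Lemma num_divide u j : num (frac_divide u) j = if D j then num u j else 0.
Proof. by []. Qed.
Lemma den_divide u j : den (frac_divide u) j = if D j then x * den u j else 1.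
Proof. by []. Qed.

Definition fracsum_divide (y : fracsum) : fracsum := \pi_fracsum (frac_divide (repr y)).

Lemma pi_frac_divide u : fracsum_divide (\pi_fracsum u) = \pi_fracsum (frac_divide u).
Proof.
apply/eqmodP/asboolP => j; rewrite !num_divide !den_divide.
case: ifP => Dj; last by rewrite subrr; apply: P0.
by rewrite !(mulrCA _ x) -mulrBr; apply: (PM); apply: frac_rel_repr.
Qed.

Lemma fracsum_divide_linear : linear fracsum_divide.
Proof.
move=> a; elim/fracsum_ind => u; elim/fracsum_ind => v.
rewrite [_ *: _]pi_frac_scale [_ + _]pi_frac_add !pi_frac_divide.
rewrite [_ *: _]pi_frac_scale [RHS]pi_frac_add.
apply: pi_fracP => j; rewrite !(num_divide, den_divide, fracE).
by case: ifP => _; ring.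
Qed.

HB.instance Definition _ := GRing.isLinear.Build R fracsum fracsum _
  fracsum_divide fracsum_divide_linear.

Lemma zero_at_divide y j : ~~ D j -> zero_at (fracsum_divide y) j.
Proof.
elim/fracsum_ind: y => u /negPf Dj; rewrite pi_frac_divide.
by apply/zero_at_pi; rewrite num_divide Dj.
Qed.

Lemma fracsum_divideK y j : D j -> zero_at (fracsum_divide (x *: y) - y) j.
Proof.
elim/fracsum_ind: y => u Dj.
rewrite [x *: _]pi_frac_scale pi_frac_divide [- _]pi_frac_scale [_ + _]pi_frac_add.
apply/zero_at_pi; rewrite !(num_divide, den_divide, fracE) Dj.
by rewrite [X in P j X](_ : _ = 0) //; ring.
Qed.

End Divide.

(** [T k] divides by [x k] on the components j with [i j = k], so that each component receives
    exactly one nonzero contribution at most, namely y itself. *)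
Lemma fracsum_partition m (x : 'I_m -> R) (i : nat -> 'I_m) :
  (forall j, ~ P j (x (i j))) ->
  exists T : 'I_m -> {linear fracsum -> fracsum}, forall y, \sum_k T k (x k *: y) = y.
Proof.
move=> xi; have xD k j : i j == k -> ~ P j (x k) by move=> /eqP <-.
exists (fun k => fracsum_divide (xD k)) => y.
apply/eqP; rewrite -subr_eq0; apply/eqP/zero_at_eq0 => j.
rewrite (bigD1 (i j)) //= addrAC; apply: zero_atD; first exact: fracsum_divideK.
elim/big_ind: _ => [||k]; [exact: zero_at0 | by move=> ? ?; apply: zero_atD |].
by rewrite eq_sym => Dj; apply: (zero_at_divide (xD k) _ Dj).
Qed.

End FractionSum.

(** * Semisimplicity implies finiteness *)

Section SemisimpleFinite.
Variable R : comPzRingType.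

Definition dense_seq (s : seq R) := forall r, (forall a, a \in s -> a * r = 0) -> r = 0.

(** For prime [P], this is membership in the set X: density of a finitely generated ideal is tested
    on its generators. *)
Definition no_dense_seq (P : R -> Prop) :=
  forall s : seq R, (forall a, a \in s -> P a) -> ~ dense_seq s.

Lemma dense_seq_mul s t : dense_seq s -> dense_seq t -> dense_seq [seq x * y | x <- s, y <- t].
Proof.
move=> s_dense t_dense r str; apply: s_dense => x xs; apply: t_dense => y yt.
by rewrite mulrA (mulrC y); apply: str; apply/allpairsP; exists (x, y).
Qed.

(** Take [P] maximal among the ideals containing Ann(a) and no dense sequence; Ann(a) qualifies,
    since a dense sequence in it would force a = 0. If x and y are not in [P], then P + Rx and P +
    Ry contain dense sequences. Their products form a dense sequence, which would lie in [P] if x y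
    did. *)
Lemma avoiding_prime (a : R) : a != 0 -> exists P : R -> Prop,
  [/\ prime_ideal P, no_dense_seq P & forall x, x * a = 0 -> P x].
Proof.
move=> a_neq0.
pose good (S : set R) := [/\ S 0, forall c x y, S x -> S y -> S (c * x + y) & no_dense_seq S].
have [|C [X0 CX0] CP Ctot|P [annP [P0 Plin Pnd] maxP]] :=
    @Zorn_above R good [set x | x * a = 0]%classic.
- split=> [|c x y xa ya|s sa /(_ a)]; rewrite /= ?mul0r //.
    by rewrite mulrDl -mulrA xa ya mulr0 addr0.
  by move=> sa0; move/eqP: a_neq0; apply; apply: sa0.
- split=> [|c x y [X CX Xx] [Y CY Yy]|s sC].
  + by exists X0 => //; case: (CP _ CX0).
  + have [XY|YX] := Ctot _ _ CX CY.
      by exists Y => //; case: (CP _ CY) => _ + _; apply => //; apply: XY.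
    by exists X => //; case: (CP _ CX) => _ + _; apply => //; apply: YX.
  (* A finite list in the union of a chain lies in one of its members. *)
  have [X CX sX] : exists2 X, C X & forall b, b \in s -> X b.
    elim: s sC => [|b s IH] sC; first by exists X0.
    have [|X CX sX] := IH; first by move=> c cs; apply: sC; rewrite inE cs orbT.
    have [Y CY Yb] := sC b (mem_head b s).
    have [XY|YX] := Ctot _ _ CX CY.
      by exists Y => // c; rewrite inE => /predU1P[->//|/sX/XY].
    by exists X => // c; rewrite inE => /predU1P[->|/sX//]; apply: YX.
  by case: (CP _ CX) => _ _; apply.
have PM c x : P x -> P (c * x) by move=> Px; rewrite -[_ * _]addr0; apply: Plin.
have PD x y : P x -> P y -> P (x + y) by move=> Px Py; rewrite -[x]mul1r; apply: Plin.
have adjoin x : ~ P x -> exists2 s, dense_seq s &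
    forall b, b \in s -> exists c y, P y /\ b = c * x + y.
  move=> nPx; apply: contrapT => no_s; apply: nPx.
  pose S := [set b | exists c y, P y /\ b = c * x + y]%classic.
  apply: (maxP S) => [y Py||]; first by exists 0, y; rewrite mul0r add0r.
    split=> [|d _ _ [c [y [Py ->]]] [c' [y' [Py' ->]]]|s sS s_dense].
    - by exists 0, 0; rewrite mul0r addr0.
    - by exists (d * c + c'), (d * y + y'); split; [apply: Plin | ring].
    - by apply: no_s; exists s.
  by exists 1, 0; rewrite mul1r addr0.
exists P; split=> //; split=> // [P1|x y Pxy].
  apply: (Pnd [:: 1]) => [b|r /(_ 1)]; first by rewrite inE => /eqP ->.
  by rewrite mul1r; apply; rewrite mem_head.
apply: contrapT => /not_orP[/adjoin[s s_dense sP] /adjoin[t t_dense tP]].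
apply: Pnd (dense_seq_mul s_dense t_dense) => _ /allpairsP[[b d] /= [/sP + /tP + ->]].
move=> [c [z [Pz ->]]] [c' [z' [Pz' ->]]].
rewrite (_ : _ * _ = c * c' * (x * y) + ((c * x + z) * z' + c' * y * z)); last by ring.
by apply: (PD); [|apply: (PD)]; apply: (PM).
Qed.

Lemma fracsum_strongly_Lucas (P : nat -> R -> Prop)
    (Pprime : forall j, prime_ideal (P j)) :
  (forall j, no_dense_seq (P j)) -> strongly_Lucas (fracsum Pprime).
Proof.
move=> Pnd.
have part I : calQ I -> exists m (x : 'I_m -> R)
    (T : 'I_m -> {linear fracsum Pprime -> fracsum Pprime}),
    (forall k, x k \in I) /\ forall y, \sum_k T k (x k *: y) = y.
  move=> [[s sI] [J [JI [t tJ] J_dense]]].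
  (* Otherwise [P j] contains [I], hence the generators [t] of [J], which form a dense sequence. *)
  have s_out j : exists k : 'I_(size s), ~ P j s`_k.
    apply: contrapT => /forallNP sP; apply: (Pnd j t) => [b bt|r tr].
      have /JI/sI[c ->] : b \in J.
        apply/tJ; exists (fun k => (k == index b t :> nat)%:R).
        have bt' : (index b t < size t)%N by rewrite index_mem.
        rewrite (bigD1 (Ordinal bt')) //= big1 ?addr0 => [|k /negPf kb].
          by rewrite eqxx mul1r nth_index.
        by move: kb; rewrite -val_eqE /= => ->; rewrite mul0r.
      apply: prime_ideal_sum => // k _; apply: prime_idealM => //.
      by apply: contrapT; apply: sP.
    apply: J_dense => b /tJ[c ->]; rewrite mulr_suml big1 // => k _.
    by rewrite -mulrA tr ?mulr0 // mem_nth.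
  pose i j := projT1 (cid (s_out j)).
  have [|T TK] := @fracsum_partition _ _ Pprime _ (fun k : 'I_(size s) => s`_k) i.
    by move=> j; rewrite /i; case: cid.
  exists (size s), (fun k => s`_k), T; split=> // k; apply/sI.
  exists (fun l => (l == k)%:R); rewrite (bigD1 k) //= big1 ?addr0 => [|l /negPf ->].
    by rewrite eqxx mul1r.
  by rewrite mul0r.
split=> [I /part[m [x [T [xI TK]]]] y Iy|I /part[m [x [T [xI TK]]]] k k_gt0].
  by rewrite -[y]TK big1 // => i _; rewrite Iy // linear0.
by apply: Ext_eq0_annihilated TK k_gt0 => i y; apply: scale_quot_ideal_eq0.
Qed.

Hypothesis R_ss : tauq_semisimple R.

Lemma semisimple_avoiding_prime (a : R) : a != 0 -> exists P : R -> Prop,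
  [/\ prime_ideal P, no_dense_seq P & ~ P a].
Proof.
move=> /avoiding_prime[P [Pprime Pnd annP]]; exists P; split=> // Pa.
pose Ps := fun _ : nat => Pprime.
(* Of the copies of the fraction field only component 0 serves: [e] is 1 there and 0 elsewhere.
   Extending c a |-> c e gives e = a z, which vanishes at 0 if a is in [P]. *)
have e_fin : exists n, forall j, (n <= j)%N -> P (j == 0%N)%:R.
  by exists 1%N => -[|j] // _; apply: prime_ideal0.
pose e : fracsum Ps := \pi_(fracsum Ps) (frac_int Ps e_fin).
have NL : strongly_Lucas (fracsum Ps) by apply: fracsum_strongly_Lucas => j.
have [|z zP] := (tauq_semisimple_extends R).1 R_ss _ NL _ (principal_phom (s := a) (y := e) _).
  move=> x; rewrite mulrC => /annP Px; apply: zero_at_eq0 => j.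
  by apply: zero_atZ; left.
have ez : e = a *: z by apply: zP; exists 1; rewrite ?mul1r ?scale1r.
have : zero_at e 0 by rewrite ez; apply: zero_atZ; left.
by move=> /zero_at_pi; rewrite num_int; apply: prime_ideal1.
Qed.

Lemma semisimple_orthogonal (x : nat -> R) :
  (forall i j, (i < j)%N -> x i * x j = 0) -> exists j, x j = 0.
Proof.
move=> x_orth; apply: contrapT => /forallNP x_neq0.
have /choice[P PP] j : exists P, [/\ prime_ideal P, no_dense_seq P & ~ P (x j)].
  by apply: semisimple_avoiding_prime; apply/eqP.
have Pprime j : prime_ideal (P j) by case: (PP j).
have NL : strongly_Lucas (fracsum Pprime).
  by apply: fracsum_strongly_Lucas => j; case: (PP j).
pose fin (r : R) := exists n, forall j, (n <= j)%N -> P j (r * x j).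
pose F (r : R^o) (y : fracsum Pprime) :=
  exists h : fin r, y = \pi_(fracsum Pprime) (frac_int Pprime h).
have homF : partial_hom F.
  split=> [|c r r' y y' [h ->] [h' ->]|y [h ->]].
  - have h : fin 0 by exists 0%N => j _; rewrite mul0r; apply: prime_ideal0.
    by exists h; apply: pi_fracP => j; rewrite !fracE !mul0r.
  - have h2 : fin (c * r + r').
      have [n rn] := h; have [n' rn'] := h'; exists (maxn n n') => j.
      rewrite geq_max => /andP[/rn Pr /rn' Pr']; rewrite mulrDl -mulrA.
      by apply: prime_idealD => //; apply: prime_idealM.
    exists h2; rewrite [_ *: _]pi_frac_scale [_ + _]pi_frac_add; apply: pi_fracP => j.
    by rewrite !fracE !mulr1 mulrA -mulrDl.
  - by apply: pi_fracP => j; rewrite !fracE !mul0r.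
have [z zP] := (tauq_semisimple_extends R).1 R_ss _ NL _ homF.
(* Past the support of z, the n-th component of x_n z is 0. But x_n is in the domain of [F], as it
   kills all later x_j, and its image has n-th component x_n x_n, which is not in [P n]. *)
have [n zn] := zero_at_fin z.
have h : fin (x n).
  by exists n.+1 => j nj; rewrite x_orth //; apply: prime_ideal0.
have : zero_at (x n *: z) n by apply: zero_atZ; right; apply: zn.
rewrite -(zP (x n) _ (ex_intro _ h erefl)) => /zero_at_pi; rewrite num_int.
by case: (PP n) => Pn _ nx /(prime_ideal_or Pn)[].
Qed.

(** Equivalently, Ann(u) is a prime ideal. *)
Definition uniform (u : R) :=
  u != 0 /\ forall x y, x * y * u = 0 -> x * u = 0 \/ y * u = 0.

Lemma uniform_prime u : uniform u -> prime_ideal (fun x => x * u = 0).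
Proof.
case=> /eqP u_neq0 u_or; split=> // [|x y xu yu|a x xu|]; rewrite ?mul0r ?mul1r //.
  by rewrite mulrDl xu yu addr0.
by rewrite -mulrA xu mulr0.
Qed.

Lemma dependent_choice_in T (S : T -> T -> Prop) (A : T -> Prop) (t0 : T) : A t0 ->
  (forall t, A t -> exists t', A t' /\ S t t') ->
  exists f : nat -> T, [/\ f 0%N = t0, forall n, A (f n) & forall n, S (f n) (f n.+1)].
Proof.
move=> At0 step.
have /choice[g gP] t : exists t', A t -> A t' /\ S t t'.
  by have [At|nAt] := pselect (A t); [case: (step t At) => t'; exists t' | exists t].
exists (fun n => iter n g t0); suff A_iter n : A (iter n g t0).
  by split=> // n; case: (gP _ (A_iter n)).
by elim: n => // n /gP[].
Qed.

Lemma uniform_multiple a : a != 0 -> exists r, uniform (r * a).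
Proof.
move=> a_neq0; apply: contrapT => /forallNP no_u.
(* [t.2] is the multiple of a still to be split and [t.1] the element just split off. If Ann(c) is
   not prime, some x c and y c are nonzero with x y c = 0; x c is kept and y c is split next. Later
   elements are multiples of y c, hence orthogonal to x c. *)
pose A (t : R * R) := t.2 != 0 /\ t.1 != 0 /\ exists r, t.2 = r * a.
pose S (t t' : R * R) := t'.1 * t'.2 = 0 /\ exists r r', t'.1 = r * t.2 /\ t'.2 = r' * t.2.
have [|[b c] [/= c_neq0 [b_neq0 [r cE]]]|f [_ Af Sf]] := @dependent_choice_in _ S A (a, a).
- by do 2!split=> //; exists 1; rewrite mul1r.
- have /not_andP[//|] := no_u r; first by rewrite -cE.
  move=> /existsNP[x /existsNP[y /not_implyP[xyc /not_orP[/eqP xc /eqP yc]]]].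
  rewrite -cE in xyc xc yc; exists (x * c, y * c); split; split=> //=.
  + by split=> //; exists (y * r); rewrite cE mulrA.
  + by rewrite (_ : _ * _ = x * y * c * c); [rewrite xyc mul0r | ring].
  + by exists x, y.
have f2 i k : exists r, (f (i + k)%N).2 = r * (f i).2.
  elim: k => [|k [r rE]]; first by exists 1; rewrite addn0 mul1r.
  have [_ [_ [r' [_ r'E]]]] := Sf (i + k)%N.
  by exists (r' * r); rewrite addnS r'E rE mulrA.
(* The shift skips the initial pair (a, a), which does not come from a splitting. *)
have [i j ij|j] := @semisimple_orthogonal (fun n => (f n.+1).1); last first.
  by apply/eqP; case: (Af j.+1) => _ [].
have [r' [r [f1 _]]] := (Sf j).2; have [r2 r2E] := f2 i.+1 (j - i.+1)%N.
rewrite f1; rewrite subnKC // in r2E; rewrite r2E.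
rewrite (_ : _ * _ = r' * r2 * ((f i.+1).1 * (f i.+1).2)); last by ring.
by rewrite (Sf i).1 mulr0.
Qed.

Lemma semisimple_finite_prime_inter : finite_prime_inter R.
Proof.
suff [s [us s0]] : exists s : seq R, (forall u, u \in s -> uniform u) /\
    forall x, (forall u, u \in s -> x * u = 0) -> x = 0.
  exists (size s), (fun i x => x * s`_i = 0); split=> [i|x xs].
    by apply: uniform_prime; apply: us; apply: mem_nth.
  by apply: s0 => u us'; have := xs (Ordinal (etrans (index_mem u s) us')); rewrite /= nth_index.
apply: contrapT => no_s.
pose A (s : seq R) := forall u, u \in s -> uniform u.
(* A list of uniform elements with a nonzero common annihilator x is prolonged by a uniform multiple
   of x. The new heads, starting with that of [f 1] since [f 0] is empty, are nonzero and pairwise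
   orthogonal. *)
pose S (s s' : seq R) := exists2 u, s' = u :: s & forall v, v \in s -> u * v = 0.
have [//|s us|f [_ Af Sf]] := @dependent_choice_in _ S A [::].
  have [x xs /eqP/uniform_multiple[r ru]] :
      exists2 x, forall u, u \in s -> x * u = 0 & x <> 0.
    apply: contrapT => nx; apply: no_s; exists s; split=> // x xs.
    by apply: contrapT => x0; apply: nx; exists x.
  exists (r * x :: s); split=> [u|]; first by rewrite inE => /predU1P[->//|/us].
  by exists (r * x) => // v /xs vx; rewrite -mulrA vx mulr0.
have f_sub i k : {subset f i <= f (i + k)%N}.
  elim: k => [|k IH] u ui; first by rewrite addn0.
  by rewrite addnS; have [v -> _] := Sf (i + k)%N; rewrite inE IH ?orbT.
have head_in j : head 0 (f j.+1) \in f j.+1.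
  by have [u -> _] := Sf j; rewrite mem_head.
have [i j ij|j] := @semisimple_orthogonal (fun n => head 0 (f n.+1)); last first.
  by apply/eqP; case: (Af _ _ (head_in j)).
have [u -> uj] := Sf j; rewrite mulrC; apply: uj.
by rewrite -(subnKC ij); apply: f_sub.
Qed.

End SemisimpleFinite.

Theorem corollary4p6 (R : comPzRingType) (n : nat) (hn : (0 < n)%N) :
  tauq_semisimple R <-> tauq_semisimple (mpowser n R).
Proof.
have ssP (S : comPzRingType) : tauq_semisimple S <-> finite_prime_inter S.
  split; first exact: semisimple_finite_prime_inter.
  exact: finite_prime_inter_semisimple.
by rewrite !ssP; apply: finite_prime_inter_mpowser.
Qed.
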